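(* Let $(Y,\sigma)$ be a symbolic minimal set. Then $(Y,\sigma)$ is topologically conjugate to the Toeplitz minimal set $(T,\sigma)$ if and only if there exist $k\ge 0$ and $2^k$-blocks $C_0\neq C_1$ such that some point in $Y$ can be written as a concatenation of $C_0$ and $C_1$ that, thought of as a bilaterally infinite sequence on the letters $C_0$ and $C_1$, contains no block of the form $BB$ where $B$ is nonempty and the number of occurrences of $C_0$ in $B$ is even. Moreover, for given such $k$, $C_0$, $C_1$, if some point in $Y$ can be so written, then every point in $Y$ can be so written.
   Context: $\sigma$ denotes the left shift on bilaterally infinite sequences, $[\sigma(x)]_i=x_{i+1}$. A symbolic minimal set $(Y,\sigma)$ is a nonempty closed subset $Y$ of $A^{\mathbb Z}$ (product topology), $A$ a finite alphabet, with $\sigma(Y)=Y$ and with every shift orbit dense in $Y$. Two systems $(X,S)$ and $(Y,R)$ are topologically conjugate if there is a homeomorphism $h:X\to Y$ with $h\circ S=R\circ h$. A block is a finite word, and an $n$-block is a word of length $n$; here $C_0,C_1$ are words over the alphabet of $Y$. A point $y=(y_i)_{i\in\mathbb Z}$ is written as a concatenation of the $2^k$-blocks $C_0$ and $C_1$ if there are an offset $j\in\mathbb Z$ and a sequence $s=(s_n)\in\{0,1\}^{\mathbb Z}$ such that $y_{j+2^kn}\,y_{j+2^kn+1}\dots y_{j+2^kn+2^k-1}=C_{s_n}$ for all $n\in\mathbb Z$. Thought of as a sequence on the letters $C_0,C_1$, the concatenation is the sequence $(C_{s_n})_{n\in\mathbb Z}$ (equivalently, $s$), and blocks $B$ are finite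 words in the two symbols $C_0,C_1$. Zero is an even number. The Toeplitz substitution is $\tau(0)=01$, $\tau(1)=00$. It determines a map $\overline\tau:\{0,1\}^{\mathbb Z}\to\{0,1\}^{\mathbb Z}$ by $[\overline\tau(x)]_{2n}[\overline\tau(x)]_{2n+1}=\tau(x_n)$ for all $n\in\mathbb Z$. The map $\overline\tau$ has exactly two periodic points, $t_{0.0}$ and $t_{1.0}$, where $t_{a.0}$ is the unique point $x$ fixed by $\overline\tau^{\,2}$ with $x_{-1}=a$ and $x_0=0$; they have the same shift orbit closure. The Toeplitz minimal set is $T=\mathrm{cl}\{\sigma^n(t_{0.0}):n\in\mathbb Z\}=\mathrm{cl}\{\sigma^n(t_{1.0}):n\in\mathbb Z\}$. *)

(* Defs.v *)
From HB Require Import structures.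
From mathcomp Require Import all_boot all_order all_algebra zify.
From mathcomp Require Import all_classical.
From mathcomp Require Import topology.

Set Implicit Arguments.
Unset Strict Implicit.
Unset Printing Implicit Defensive.

Import Order.TTheory GRing.Theory Num.Theory.
Local Open Scope classical_set_scope.
Local Open Scope ring_scope.

Definition fullshift (A : choiceType) : Type :=
  prod_topology (fun _ : int => discrete_topology A).

HB.instance Definition _ (A : choiceType) :=
  Topological.copy (fullshift A)
    (prod_topology (fun _ : int => discrete_topology A)).

Definition shift (A : choiceType) (x : fullshift A) : fullshift A :=
  fun i => x (i + 1).

Definition shiftz (A : choiceType) (n : int) (x : fullshift A) : fullshift A :=
  fun i => x (i + n).

(* shiftz n is the n-th power of the (invertible) map shift. *)
Lemma shiftz0 (A : choiceType) (x : fullshift A) : shiftz 0 x = x.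
Proof. by apply: funext => i; rewrite /shiftz addr0. Qed.

Lemma shiftzS (A : choiceType) (n : int) (x : fullshift A) :
  shiftz (n + 1) x = shift (shiftz n x).
Proof. by apply: funext => i; rewrite /shift /shiftz -addrA (addrC 1). Qed.

Definition orbit_closure (A : choiceType) (x : fullshift A) :
    set (fullshift A) :=
  closure (range (fun n : int => shiftz n x)).

Definition symbolic_minimal_set (A : finType) (Y : set (fullshift A)) : Prop :=
  [/\ Y !=set0, closed Y, shift (A := A) @` Y = Y
    & forall y, Y y -> Y `<=` orbit_closure y].

(* Only the values of h on X and of its inverse g on Y matter: h restricts to
   a homeomorphism from the subspace X onto the subspace Y. *)
Definition conjugate (U V : topologicalType)
    (X : set U) (S : U -> U) (Y : set V) (R : V -> V) : Prop :=
  exists h : U -> V,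
    [/\ set_bij X Y h, {within X, continuous h},
        exists2 g : V -> U, {within Y, continuous g} & {in X, cancel h g}
      & forall x, X x -> h (S x) = R (h x)].

Definition window (A : choiceType) (x : fullshift A) (m : int) (n : nat) :
    seq A :=
  mkseq (fun i => x (m + i%:Z)) n.

Definition occurs_in (A : choiceType) (w : seq A) (x : fullshift A) : Prop :=
  exists m : int, window x m (size w) = w.

(* In sequences on the letters C0, C1 the letter false stands for C0 and
   true for C1. *)
Definition concatenation (A : choiceType) (k : nat) (C0 C1 : (2 ^ k).-tuple A)
    (j : int) (s : fullshift bool) (y : fullshift A) : Prop :=
  forall n : int,
    window y (j + (2 ^ k)%:Z * n) (2 ^ k) = (if s n then C1 else C0) :> seq A.

Definition no_even_square (s : fullshift bool) : Prop :=
  forall B : seq bool, B != [::] -> ~~ odd (count_mem false B) ->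
    ~ occurs_in (B ++ B) s.

Definition so_written (A : choiceType) (k : nat) (C0 C1 : (2 ^ k).-tuple A)
    (y : fullshift A) : Prop :=
  exists (j : int) (s : fullshift bool),
    concatenation C0 C1 j s y /\ no_even_square s.

(* The letters 0 and 1 are false and true. *)
Definition tau (b : bool) : seq bool :=
  if b then [:: false; false] else [:: false; true].

Definition taubar (x : fullshift bool) : fullshift bool :=
  fun i => nth false (tau (x (i %/ 2)%Z)) `|(i %% 2)%Z|.

Lemma taubarP (x : fullshift bool) (n : int) :
  [:: taubar x (2 * n); taubar x (2 * n + 1)] = tau (x n).
Proof.
rewrite /taubar.
have -> : (2 * n %/ 2)%Z = n by lia.
have -> : ((2 * n + 1) %/ 2)%Z = n by lia.
have -> : (2 * n %% 2)%Z = 0 by lia.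
have -> : ((2 * n + 1) %% 2)%Z = 1 by lia.
by case: (x n).
Qed.

Definition is_toeplitz_point (a : bool) (x : fullshift bool) : Prop :=
  [/\ taubar (taubar x) = x, x (- 1) = a & x 0 = false].

Lemma taubar_even (x : fullshift bool) (n : int) : taubar x (2 * n) = false.
Proof. by move: (taubarP x n); case: (x n) => -[]. Qed.

Lemma taubar_odd (x : fullshift bool) (n : int) :
  taubar x (2 * n + 1) = ~~ x n.
Proof. by move: (taubarP x n); case: (x n) => -[]. Qed.

Lemma is_toeplitz_point_unique (a : bool) (x y : fullshift bool) :
  is_toeplitz_point a x -> is_toeplitz_point a y -> x = y.
Proof.
have rec (z : fullshift bool) m : taubar (taubar z) = z ->
    [/\ z (2 * m) = false, z (2 * (2 * m) + 1) = true
      & z (2 * (2 * m + 1) + 1) = z m].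
  move=> zf; split; first by rewrite -zf taubar_even.
  - by rewrite -zf taubar_odd taubar_even.
  - by rewrite -{1}zf !taubar_odd negbK.
move=> [xf x1 x0] [yf y1 y0]; apply: funext => i.
have [n] := ubnP `|i|%N; elim: n i => // n IHn i lt_in.
have [q [-> | [-> | Ei]]] : exists q : int,
    i = 2 * q \/ i = 2 * (2 * q) + 1 \/ i = 2 * (2 * q + 1) + 1.
  have [e | [e | e]] : (i %% 2)%Z = 0 \/ (i %% 4)%Z = 1 \/ (i %% 4)%Z = 3.
  - lia.
  - by exists (i %/ 2)%Z; left; lia.
  - by exists (i %/ 4)%Z; right; left; lia.
  - by exists (i %/ 4)%Z; right; right; lia.
- by have [-> _ _] := rec x q xf; have [-> _ _] := rec y q yf.
- by have [_ -> _] := rec x q xf; have [_ -> _] := rec y q yf.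
have [e1 | ne1] := eqVneq i (- 1); first by rewrite e1 x1 y1.
rewrite Ei; have [_ _ ->] := rec x q xf; have [_ _ ->] := rec y q yf.
apply: IHn; lia.
Qed.

Lemma is_toeplitz_point_exists (a : bool) : exists x, is_toeplitz_point a x.
Proof.
pose w (b : bool) : fullshift bool :=
  fun i => if i == - 1 then b else odd (logn 2 (absz (i + 1))).
have wE b : taubar (w b) = w (~~ b).
  apply: funext => i.
  have [q [-> | ->]] : exists q : int, i = 2 * q \/ i = 2 * q + 1.
    exists (i %/ 2)%Z; lia.
  - rewrite taubar_even /w ifN; last by apply/eqP; lia.
    rewrite lognE /= [X in [&& _ & X]](_ : _ = false) ?andbF //; lia.
  - rewrite taubar_odd /w.
    have [-> // | nq] := eqVneq q (- 1); rewrite ifN; last by apply/eqP; lia.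
    have -> : absz (2 * q + 1 + 1) = (2 * absz (q + 1)%R)%N by lia.
    by rewrite lognM; [rewrite (pfactorK 1) | | lia].
by exists (w a); split; rewrite ?wE ?negbK.
Qed.

(* The point t_{a.0}; the default of xget is never used, see toeplitz_pointP. *)
Definition toeplitz_point (a : bool) : fullshift bool :=
  xget (fun=> false) (is_toeplitz_point a).

Lemma toeplitz_pointP (a : bool) : is_toeplitz_point a (toeplitz_point a).
Proof.
have [x xP] := is_toeplitz_point_exists a.
exact: (@xgetPex _ (fun=> false) (is_toeplitz_point a)) (ex_intro _ x xP).
Qed.

Definition toeplitz_minimal_set : set (fullshift bool) :=
  orbit_closure (toeplitz_point false).

(* Main.v *)
Require Import Defs.
From mathcomp Require Import all_boot all_order all_algebra zify.
From mathcomp Require Import all_classical.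
From mathcomp Require Import topology.

Set Implicit Arguments.
Unset Strict Implicit.
Unset Printing Implicit Defensive.

Import Order.TTheory GRing.Theory Num.Theory.
Local Open Scope classical_set_scope.
Local Open Scope ring_scope.

(** Call BB an even square if B is nonempty with an even number of 0s. The
sequences s without even squares are exactly the points of the Toeplitz minimal
set T (toeplitz_minimal_setE). The link is desubstitution. The words 11 and
0000 are even squares, and 1001 cannot occur either: the letter before it and
the letter after it would be 0, giving the even square 010010. Hence the 1s of
s all lie in one class modulo 2, which says that s is a shift of taubar u for
some u (desubstitution). Taking taubar preserves and reflects the absence of
even squares: the number of 0s in tau(B) has the parity of the number of 0s in
B, and a square in taubar u of even period can be aligned to even positions,
where it comes from a square in u (even_square_taubar, even_square_taubar_inv).
By descent on the length, the points fixed by the square of taubar have no even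
square; by descent on the length of a window, any two sequences without even
squares have the same finite words (same_language).

Let q = 2^k. A point written in the blocks C_0 and C_1 has a well defined
offset modulo q (no_intermediate_offset): the positions in a block where C_0
and C_1 differ carry the sequence s, and two different offsets would either
push this finite set of positions endlessly to the right, or endlessly to the
left, inside the block. Consequently, for another pair of distinct blocks P_0,
P_1 of the same length, replacing each C_b by P_b is a well defined bijection
between the points written in C_0, C_1 and those written in P_0, P_1. It is a
topological conjugacy because the set of points written with a given offset is
closed, and there are only finitely many offsets, so that the offset is locally
constant (recoding_conjugate).

The points written in C_0 and C_1 form a closed set in which every orbit is
dense, so this set is Y as soon as it meets Y. For the blocks tau^k(0) and
tau^k(1) the set is T (tau_written). This gives the second assertion and one
half of the equivalence.

For the other half, let g be a conjugacy from T onto Y. By compactness, the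
value of g x at 0 depends only on the coordinates of x in [-r, r]. Choose
q > 2r + 1. The blocks tau^k(0) and tau^k(1) differ only in their last letter,
so a point x of T is periodic of period q away from a set of isolated holes at
distance q. The window of g x from r places before a hole up to r places
before the next one depends only on the letter in that hole, so g x is written
in two blocks (image_written). They are distinct since otherwise g x, and hence
x, would have period q, whereas two consecutive holes of x somewhere carry
different letters. *)

(** * Cylinders, continuity and compactness in the full shift *)

Section Cylinders.
Variable A : choiceType.
Implicit Types (x y z : fullshift A) (X : set (fullshift A)).

Definition agree (N : nat) x y : Prop :=
  forall i : int, (`|i| <= N)%N -> x i = y i.

Lemma agree_trans N x y z : agree N x y -> agree N y z -> agree N x z.
Proof. by move=> xy yz i iN; rewrite xy ?yz. Qed.

Lemma agreeW M N x y : (M <= N)%N -> agree N x y -> agree M x y.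
Proof. by move=> MN xy i iM; apply: xy; apply: leq_trans MN. Qed.

(** The filter generated by the cylinders around x converges to x in each
coordinate, hence in the product topology; conversely a cylinder is a finite
intersection of preimages of points of a discrete space. *)
Lemma nbhs_fullshiftP x (U : set (fullshift A)) :
  nbhs x U <-> exists N, agree N x `<=` U.
Proof.
split=> [|[N NU]].
- pose F : set_system (fullshift A) :=
    fun V => exists N, agree N x `<=` V.
  have FF : Filter F.
    split=> [|V W [M MV] [N NW]|V W VW [N NV]].
    + by exists 0%N.
    + exists (maxn M N) => y xy; split; [apply: MV|apply: NW].
        by apply: agreeW xy; rewrite leq_maxl.
      by apply: agreeW xy; rewrite leq_maxr.
    + by exists N; apply: subset_trans VW.
  suff : F --> x by exact.
  apply/cvg_sup => i V [W [[O _ <-] xO] OV].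
  exists `|i|%N => y xy; apply: OV => /=.
  by rewrite -xy.
have nx (n : 'I_(N + N).+1) :
    nbhs x [set y | x (n%:Z - N%:Z) = y (n%:Z - N%:Z)].
  have : nbhs x (proj (n%:Z - N%:Z) @^-1` [set x (n%:Z - N%:Z)]) :=
    @proj_continuous int (fun=> discrete_topology A) _ x _ (discrete_set1 _).
  by apply: filterS => y /= <-.
apply: filterS (@filter_forall _ _ _ (nbhs x) _ nx) => y /= xy.
apply: NU => i iN.
have lt_i : (`|(i + N%:Z)%R| < (N + N).+1)%N by lia.
have := xy (Ordinal lt_i).
by have -> : (Ordinal lt_i)%:Z - N%:Z = i by rewrite /=; lia.
Qed.

Lemma closure_fullshiftP X x :
  closure X x <-> forall N, exists2 y, X y & agree N x y.
Proof.
split=> [clX N|agrX U /nbhs_fullshiftP[N NU]].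
- have /clX[y [Xy xy]] : nbhs x (agree N x) by apply/nbhs_fullshiftP; exists N.
  by exists y.
- by have [y Xy xy] := agrX N; exists y; split=> //; apply: NU.
Qed.

End Cylinders.

Lemma within_continuousP (A B : choiceType) (X : set (fullshift A))
    (f : fullshift A -> fullshift B) :
  {within X, continuous f} <->
  forall x i, X x ->
    exists N, forall x', X x' -> agree N x x' -> f x i = f x' i.
Proof.
rewrite subspace_continuousP; split=> [fc x i Xx|fc x Xx U].
- have /fc : X x by [].
  move=> /(_ [set y | f x i = y i]) H.
  have : nbhs (f x) [set y | f x i = y i].
    by apply/nbhs_fullshiftP; exists `|i|%N => y; apply.
  move/H; rewrite nbhs_simpl /= /within /= => /nbhs_fullshiftP[N NU].
  by exists N => x' Xx' xx'; apply: NU.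
- move=> /nbhs_fullshiftP[M MU]; rewrite nbhs_simpl /= /within /=.
  have /choice[N NP] : forall n : 'I_(M + M).+1, exists N, forall x', X x' ->
      agree N x x' -> f x (n%:Z - M%:Z) = f x' (n%:Z - M%:Z).
    by move=> n; apply: fc.
  apply/nbhs_fullshiftP; exists (\max_n N n) => x' xx' Xx'; apply: MU => i iM.
  have lt_i : (`|(i + M%:Z)%R| < (M + M).+1)%N by lia.
  have := NP (Ordinal lt_i) x' Xx'.
  have -> : (Ordinal lt_i)%:Z - M%:Z = i by rewrite /=; lia.
  by apply; apply: agreeW xx'; apply: leq_bigmax.
Qed.

(** The compactness half of the Curtis-Hedlund-Lyndon theorem. *)
Lemma uniform_local_rule (A : finType) (B : choiceType) (X : set (fullshift A))
    (f : fullshift A -> fullshift B) (i : int) :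
  closed X -> {within X, continuous f} ->
  exists N, forall x x', X x -> X x' -> agree N x x' -> f x i = f x' i.
Proof.
move=> clX /within_continuousP fc.
have cX : compact X.
  apply: (subclosed_compact clX (B := setT)) => //.
  have -> : [set: fullshift A] =
      [set x | forall i, [set: discrete_topology A] (x i)].
    by apply/seteqP; split.
  apply: (@tychonoff int (fun=> discrete_topology A) (fun=> setT)) => _.
  exact/finite_compact/(@finite_finset A).
have /near_covering_withinP := proj1 (compact_near_coveringP X) cX.
move=> /(_ nat \oo
  (fun N x => forall x', X x' -> agree N x x' -> f x i = f x' i)).
case=> [x Xx|N _ NP].
- have [N NP] := fc x i Xx.
  exists (agree N x, [set n | (N <= n)%N]) => /=.
    split; last by exists N.
    by apply/nbhs_fullshiftP; exists N.
  move=> [x' n] /= [xx' Nn] Xx' x'' Xx'' x'x''.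
  rewrite -(NP x') // -(NP x'') //; apply: (agree_trans xx').
  exact: agreeW x'x''.
- by exists N => x x' Xx; apply: NP; rewrite /= ?leqnn.
Qed.

(** * Windows *)

Section Windows.
Variable A : choiceType.
Implicit Types x y : fullshift A.

Lemma window_cat x m a b :
  window x m (a + b) = window x m a ++ window x (m + a%:Z) b.
Proof.
rewrite /window /mkseq iotaD map_cat; congr (_ ++ _).
rewrite add0n -{1}[a]addn0 iotaDl -map_comp; apply: eq_map => i /=.
by rewrite PoszD addrA.
Qed.

Lemma eq_windowP x y m n l :
  window x m l = window y n l <->
  forall i, (i < l)%N -> x (m + i%:Z) = y (n + i%:Z).
Proof.
split=> [e i il|e].
  have := congr1 (fun w => nth (x (m + i%:Z)) w i) e.
  by rewrite !nth_mkseq.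
apply: (@eq_from_nth _ (x m)); rewrite !size_mkseq // => i il.
by rewrite !nth_mkseq // e.
Qed.

End Windows.

(** * Even squares and the substitution *)

Implicit Types s u : fullshift bool.

(** An occurrence at m of a word BB with l the length of B, expressed by
coordinates rather than by words so that it can be moved and halved. *)
Definition even_square s (m : int) (l : nat) : Prop :=
  [/\ (0 < l)%N, forall i : nat, (i < l)%N -> s (m + i%:Z) = s (m + l%:Z + i%:Z)
    & ~~ odd (count_mem false (window s m l))].

Lemma no_even_squareP s :
  no_even_square s <-> forall m l, ~ even_square s m l.
Proof.
split=> [ns m l [l0 per ev]|ns B B0 ev [m Bm]].
- apply: (ns (window s m l)) => //.
    by rewrite -size_eq0 size_mkseq -lt0n.
  exists m; rewrite size_cat size_mkseq window_cat; congr (_ ++ _).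
  by apply/esym/eq_windowP.
- move: Bm; rewrite size_cat window_cat => /eqP.
  rewrite eqseq_cat ?size_mkseq // => /andP[/eqP B1 /eqP B2].
  apply: (ns m (size B)); split; last by rewrite B1.
    by rewrite lt0n size_eq0.
  by apply/eq_windowP; rewrite B1.
Qed.

Lemma no_even_square_shiftz s n :
  no_even_square s -> no_even_square (shiftz n s).
Proof.
move=> /no_even_squareP ns; apply/no_even_squareP => m l [l0 per ev].
apply: (ns (m + n) l); split=> // [i il|].
  have := per i il; rewrite /shiftz => e.
  have -> : m + n + i%:Z = m + i%:Z + n by lia.
  by rewrite e; congr s; lia.
suff <- : window (shiftz n s) m l = window s (m + n) l by [].
by apply/eq_windowP => i il; rewrite /shiftz; congr s; lia.
Qed.

(** The word tau(0) has one 0 and tau(1) has two. *)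
Lemma odd_zeros_taubar u m l :
  odd (count_mem false (window (taubar u) (2 * m) (l + l))) =
  odd (count_mem false (window u m l)).
Proof.
elim: l => // l IH.
have -> : (l.+1 + l.+1 = l + l + 2)%N by lia.
rewrite (window_cat _ _ (l + l)) -[in RHS]addn1 (window_cat u).
rewrite !count_cat !oddD IH; congr addb; rewrite /window /=.
have -> : 2 * m + (l + l)%:Z + 0%:Z = 2 * (m + l%:Z) by lia.
have -> : 2 * m + (l + l)%:Z + 1%:Z = 2 * (m + l%:Z) + 1 by lia.
by rewrite taubar_even taubar_odd addr0; case: (u _).
Qed.

Lemma even_square_taubar u m l :
  even_square u m l -> even_square (taubar u) (2 * m) (l + l).
Proof.
move=> [l0 per ev]; split; first by rewrite addn_gt0 l0.
- move=> i il; have [e|e] : i = (i./2 + i./2)%N \/ i = (i./2 + i./2).+1 by lia.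
  + have -> : 2 * m + i%:Z = 2 * (m + i./2%:Z) by lia.
    have -> : 2 * m + (l + l)%:Z + i%:Z = 2 * (m + l%:Z + i./2%:Z) by lia.
    by rewrite !taubar_even.
  + have -> : 2 * m + i%:Z = 2 * (m + i./2%:Z) + 1 by lia.
    have -> : 2 * m + (l + l)%:Z + i%:Z = 2 * (m + l%:Z + i./2%:Z) + 1 by lia.
    by rewrite !taubar_odd per //; lia.
- by rewrite odd_zeros_taubar.
Qed.

(** Letters of taubar u at even positions are 0. A square of odd period in
taubar u therefore consists of 0s only, an odd number of them in each half. A
square of even period starting at an odd position can be moved one place to the
left: this exchanges one 0 for another. Once it starts at an even position it
is the image of a square in u. *)
Lemma even_square_taubar_inv u m l :
  even_square (taubar u) m l -> exists m', even_square u m' l./2.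
Proof.
move=> [l0 per ev].
have [eo|eo] : l = l./2.*2 \/ l = l./2.*2.+1 by lia.
(* [H] treats an even start; the case of an odd start is reduced to it. *)
- have H n : even_square (taubar u) (2 * n) l -> even_square u n l./2.
    move=> [_ pern evn]; split; first lia.
      move=> i il; apply: negb_inj; rewrite -!taubar_odd.
      have -> : 2 * (n + i%:Z) + 1 = 2 * n + i.*2.+1%:Z by lia.
      by rewrite pern; [congr taubar|]; lia.
    by rewrite -odd_zeros_taubar addnn -eo.
  have [em|em] : m = 2 * (m %/ 2)%Z \/ m = 2 * (m %/ 2)%Z + 1 by lia.
    by exists (m %/ 2)%Z; apply: H; rewrite -em.
  exists (m %/ 2)%Z; apply: H; set n := (m %/ 2)%Z in em *; split=> //.
    case=> [|i] il.
      have -> : 2 * n + l%:Z + 0%:Z = 2 * (n + l./2%:Z) by lia.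
      by rewrite addr0 !taubar_even.
    have -> : 2 * n + i.+1%:Z = m + i%:Z by lia.
    have -> : 2 * n + l%:Z + i.+1%:Z = m + l%:Z + i%:Z by lia.
    by apply: per; lia.
  suff -> : count_mem false (window (taubar u) (2 * n) l) =
            count_mem false (window (taubar u) m l) by [].
  have e1 := window_cat (taubar u) (2 * n) 1 l.
  have := window_cat (taubar u) (2 * n) l 1.
  rewrite addnC e1 => /(congr1 (count_mem false)).
  rewrite !count_cat /window /=.
  have -> : 2 * n + l%:Z + 0%:Z = 2 * (n + l./2%:Z) by lia.
  by rewrite addr0 !taubar_even em /= addnC => /addIn.
- have z i : (i < l)%N -> taubar u (m + i%:Z) = false.
    move=> il; have [e|e] : (exists n, m + i%:Z = 2 * n) \/
        exists n, m + l%:Z + i%:Z = 2 * n.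
      have [e|e] : (m + i%:Z) = 2 * ((m + i%:Z) %/ 2)%Z \/
        (m + l%:Z + i%:Z) = 2 * ((m + l%:Z + i%:Z) %/ 2)%Z by lia.
        by left; eexists; exact: e.
      by right; eexists; exact: e.
    + by case: e => n ->; rewrite taubar_even.
    + by rewrite per //; case: e => n ->; rewrite taubar_even.
  have c0 : count_mem false (window (taubar u) m l) = l.
    rewrite -[RHS](size_mkseq (fun i => taubar u (m + i%:Z)) l).
    apply/eqP; rewrite -all_count; apply/allP => b /mapP[i].
    by rewrite mem_iota /= => il ->; rewrite z.
  by move: ev; rewrite c0; lia.
Qed.

Lemma no_even_square_taubar u : no_even_square (taubar u) <-> no_even_square u.
Proof.
rewrite !no_even_squareP; split=> nu m l.
- by move=> /even_square_taubar/nu.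
- by move=> /even_square_taubar_inv[m' /nu].
Qed.

(** Descent: an even square in s gives one of half the length in taubar s, which
is again fixed by the square of taubar. *)
Lemma no_even_square_taubar2_fixed s :
  taubar (taubar s) = s -> no_even_square s.
Proof.
move=> sf; apply/no_even_squareP => m l.
have [n] := ubnP l; elim: n l m s sf => // n IHn l m s sf ln es.
have [l0 _ _] := es.
have [m' es'] : exists m', even_square (taubar s) m' l./2.
  by apply: (even_square_taubar_inv (m := m)); rewrite sf.
by apply: (IHn _ m' (taubar s) _ _ es'); [rewrite sf|lia].
Qed.

(** * Desubstitution *)

Section LocalRules.
Variable s : fullshift bool.
Hypothesis ns : no_even_square s.

Lemma no_11 m : s m -> s (m + 1) = false.
Proof.
move=> sm; apply/negP => sm1; move/no_even_squareP: ns => /(_ m 1%N); apply.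
split=> //; last by rewrite /window /= addr0 sm.
by case=> // _; rewrite !addr0 sm sm1.
Qed.

Lemma no_0000 m : [|| s m, s (m + 1), s (m + 2) | s (m + 3)].
Proof.
apply: contraPT ns; rewrite !negb_or => /and4P[].
move=> /negPf s0 /negPf s1 /negPf s2 /negPf s3 /no_even_squareP/(_ m 2%N).
apply; split=> //; last by rewrite /window /= addr0 s0 s1.
by case=> [|[|//]] _; rewrite ?addr0 -?addrA ?s0 ?s1 ?s2 ?s3.
Qed.

(** Since 11 does not occur, 1001 would extend to 010010, the square of a word
with two 0s. *)
Lemma no_1001 m : s m -> s (m + 3) = false.
Proof.
move=> s0; apply/negP => s3.
have s1 := no_11 s0.
have s2 : s (m + 2) = false.
  apply/negP => /no_11; have -> : m + 2 + 1 = m + 3 by lia.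
  by rewrite s3.
have s4 : s (m + 4) = false.
  by have := no_11 s3; have -> : m + 3 + 1 = m + 4 by lia.
have sN1 : s (m - 1) = false.
  by apply/negP => /no_11; rewrite subrK s0.
move/no_even_squareP: ns => /(_ (m - 1) 3%N); apply; split=> //.
- case=> [|[|[|//]]] _.
  + by rewrite addr0 (_ : m - 1 + 3%N + 0%N = m + 2) ?sN1 ?s2 //; lia.
  + by rewrite subrK (_ : m - 1 + 3%N + 1%N = m + 3) ?s0 ?s3 //; lia.
  + rewrite (_ : m - 1 + 2%N = m + 1) ?s1; last lia.
    by rewrite (_ : m - 1 + 3%N + 2%N = m + 4) ?s4 //; lia.
- rewrite /window /= addr0 sN1 subrK s0.
  by rewrite (_ : m - 1 + 2%N = m + 1) ?s1 //; lia.
Qed.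

(** After a 1 at m there is a 1 at m + 2 or at m + 4, because 11, 1001 and 0000
do not occur; this shortens the distance d by 2 or 4. *)
Lemma no_ones_at_odd_distance m (d : nat) :
  odd d -> s m -> s (m + d%:Z) = false.
Proof.
have [n] := ubnP d; elim: n d m => // n IHn d m dn od sm.
have [->|[->|d5]] : d = 1%N \/ d = 3%N \/ (5 <= d)%N by lia.
- exact: no_11.
- exact: no_1001.
have s1 := no_11 sm; have s3 := no_1001 sm.
have /or4P[] := no_0000 (m + 1); rewrite ?s1 //.
- have -> : m + 1 + 1 = m + 2 by lia.
  move=> s2; have -> : m + d%:Z = m + 2 + (d - 2)%N%:Z by lia.
  by apply: IHn => //; lia.
- have -> : m + 1 + 2 = m + 3 by lia.
  by rewrite s3.
- have -> : m + 1 + 3 = m + 4 by lia.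
  move=> s4; have -> : m + d%:Z = m + 4 + (d - 4)%N%:Z by lia.
  by apply: IHn => //; lia.
Qed.

Lemma has_one : exists p, s p.
Proof. by have /or4P[] := no_0000 0 => ?; eexists; eassumption. Qed.

(** Take a 1 at p. All 1s lie at even distance from p, so s is 0 at the positions
p + 2n + 1, which are the first letters of the words tau(u_n). *)
Lemma desubstitution : exists j u, no_even_square u /\ s = shiftz j (taubar u).
Proof.
have [p sp] := has_one.
pose u : fullshift bool := fun n => ~~ s (p + 2 * n + 2).
have se n : s (p + 2 * n + 1) = false.
  have [n0|n0] : 0 <= n \/ n < 0 by lia.
    have := @no_ones_at_odd_distance p (`|n|.*2.+1)%N.
    have -> : p + (`|n|.*2.+1)%N%:Z = p + 2 * n + 1 by lia.
    by apply=> //; lia.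
  apply/negP => sq.
  have := @no_ones_at_odd_distance (p + 2 * n + 1) (`|n|.*2.-1)%N.
  have -> : p + 2 * n + 1 + (`|n|.*2.-1)%N%:Z = p by lia.
  by rewrite sp => H; suff : true = false by []; apply: H => //; lia.
have Es : s = shiftz (- p - 1) (taubar u).
  apply/funext => i; rewrite /shiftz.
  have [q [e|e]] : exists q, i - p - 1 = 2 * q \/ i - p - 1 = 2 * q + 1.
    by exists ((i - p - 1) %/ 2)%Z; lia.
  - by rewrite addrA e taubar_even -(se q); congr s; lia.
  - by rewrite addrA e taubar_odd negbK; congr s; lia.
exists (- p - 1), u; split=> //; apply/no_even_square_taubar.
have -> : taubar u = shiftz (p + 1) s.
  by apply/funext => i; rewrite Es /shiftz; congr taubar; lia.
exact: no_even_square_shiftz.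
Qed.

End LocalRules.

Lemma pair_occurs s (a b : bool) :
  no_even_square s -> ~~ (a && b) -> exists n, s n = a /\ s (n + 1) = b.
Proof.
move=> ns; case: a; case: b => //= _.
- by have [p sp] := has_one ns; exists p; rewrite no_11.
- have [p sp] := has_one ns; exists (p - 1); rewrite subrK; split=> //.
  by apply/negP => /(no_11 ns); rewrite subrK sp.
- have [j [u [nu ->]]] := desubstitution ns.
  have [p up] := has_one nu; exists (2 * p - j); rewrite /shiftz subrK.
  rewrite taubar_even; split=> //.
  have -> : 2 * p - j + 1 + j = 2 * p + 1 by lia.
  by rewrite taubar_odd up.
Qed.

(** * The Toeplitz minimal set *)

(** A window of length l > 2 of taubar u' is determined by a window of length
l/2 + 1 < l of u'; windows of length at most 2 are covered by pair_occurs. *)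
Lemma same_language s s' : no_even_square s -> no_even_square s' ->
  forall (l : nat) (a : int), exists b : int,
  forall i : nat, (i < l)%N -> s' (a + i%:Z) = s (b + i%:Z).
Proof.
move=> + + l; have [n] := ubnP l.
elim: n l s s' => // n IHn l s s' ln ns ns' a.
have [l2|l3] := leqP l 2.
  have [|b [b0 b1]] := @pair_occurs s (s' a) (s' (a + 1)) ns.
    by case e : (s' a); rewrite // (no_11 ns').
  exists b => -[|[|i]] il; rewrite ?addr0 ?b0 //; lia.
have [j [u [nu ->]]] := desubstitution ns.
have [j' [u' [nu' ->]]] := desubstitution ns'.
have [|b bP] := IHn l./2.+1 u u' _ nu nu' ((a + j') %/ 2)%Z; first lia.
set c := ((a + j') %/ 2)%Z in bP.
have [e [e1 ce]] : exists e : nat, (e <= 1)%N /\ a + j' = 2 * c + e%:Z.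
  by exists `|((a + j') %% 2)%Z|%N; lia.
exists (2 * b + e%:Z - j) => i il; rewrite /shiftz.
have -> : a + i%:Z + j' = 2 * c + (e + i)%N%:Z by lia.
have -> : 2 * b + e%:Z - j + i%:Z + j = 2 * b + (e + i)%N%:Z by lia.
have : (e + i <= l)%N by lia.
move: (e + i)%N => k kl.
have H : u' (c + k./2%:Z) = u (b + k./2%:Z) by apply: bP; lia.
have [ek|ek] : k = k./2.*2 \/ k = k./2.*2.+1 by lia.
- have -> : 2 * c + k%:Z = 2 * (c + k./2%:Z) by lia.
  have -> : 2 * b + k%:Z = 2 * (b + k./2%:Z) by lia.
  by rewrite !taubar_even.
- have -> : 2 * c + k%:Z = 2 * (c + k./2%:Z) + 1 by lia.
  have -> : 2 * b + k%:Z = 2 * (b + k./2%:Z) + 1 by lia.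
  by rewrite !taubar_odd H.
Qed.

Lemma no_even_square_closed s :
  (forall N, exists2 s', no_even_square s' & agree N s s') -> no_even_square s.
Proof.
move=> H; apply/no_even_squareP => m l [l0 per ev].
have [s' /no_even_squareP ns' ss'] := H (`|m| + l + l)%N.
apply: (ns' m l); split=> // [i il|]; first by rewrite -!ss' ?per //; lia.
suff <- : window s m l = window s' m l by [].
by apply/eq_windowP => i il; apply: ss'; lia.
Qed.

Lemma toeplitz_minimal_setE : toeplitz_minimal_set = no_even_square.
Proof.
have nt : no_even_square (toeplitz_point false).
  by apply: no_even_square_taubar2_fixed; have [] := toeplitz_pointP false.
apply/seteqP; split=> s.
- move=> /closure_fullshiftP cs; apply: no_even_square_closed => N.
  have [_ [n _ <-] ss'] := cs N; exists (shiftz n (toeplitz_point false)) => //.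
  exact: no_even_square_shiftz.
- move=> ns; apply/closure_fullshiftP => N.
  have [b bP] := same_language nt ns (N + N).+1 (- N%:Z).
  exists (shiftz (b + N%:Z) (toeplitz_point false)); first by exists (b + N%:Z).
  move=> i iN; have := bP `|(i + N%:Z)%R|%N.
  have -> : - N%:Z + `|(i + N%:Z)%R|%N%:Z = i by lia.
  by move=> ->; [rewrite /shiftz; congr toeplitz_point; lia|lia].
Qed.

(** * Points written in two blocks *)

(** In a sequence without even squares 00 occurs and 11 does not, so the two
letters cannot be exchanged: a recoding of such a sequence determines both the
sequence and the recoding. *)
Lemma letters_determined (A : Type) (f g : bool -> A) s s' :
  no_even_square s -> no_even_square s' -> f false <> f true ->
  (forall n, g (s n) = f (s' n)) -> g false <> g true /\ s = s'.
Proof.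
move=> ns ns' fD e.
have gD : g false <> g true.
  move=> g01; have gc b b' : g b = g b' by case: b; case: b'.
  have [n [s'0 s'1]] := @pair_occurs s' false true ns' isT.
  by apply: fD; rewrite -s'0 -s'1 -!e; apply: gc.
split=> //.
have [n [s0 s1]] := @pair_occurs s false false ns isT.
have f0 : s' n = false.
  apply/negP => s'n; have := no_11 ns' s'n; have := e n; have := e (n + 1).
  rewrite s0 s1 s'n => -> /[swap] ->; exact: fD.
have g0 : g false = f false by have := e n; rewrite s0 f0.
have [p sp] := has_one ns.
have s'p : s' p.
  apply/negPn/negP => /negPf s'p; apply: gD.
  by have := e p; rewrite sp s'p g0.
have g1 : g true = f true by have := e p; rewrite sp s'p.
apply/funext => m; have := e m; case: (s m); case: (s' m) => //.
- by rewrite g1 => /esym/fD.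
- by rewrite g0 => /fD.
Qed.

Section Layout.
Variables (A : choiceType) (q : nat) (C : bool -> 'I_q -> A).
Implicit Types (y z : fullshift A) (j n : int).

(** Blocks are functions on 'I_q, indexed by the letters of s, so that the blocks
of Y and those of T are treated alike. *)
Definition laid j s y : Prop :=
  forall n (l : 'I_q), y (j + q%:Z * n + l%:Z) = C (s n) l.

Definition written j y : Prop := exists2 s, no_even_square s & laid j s y.

Lemma laid_shift_offset j s y m :
  laid j s y -> laid (j + q%:Z * m) (shiftz m s) y.
Proof.
move=> L n l; rewrite /shiftz -L; congr y.
by rewrite mulrDr [q%:Z * n + _]addrC !addrA.
Qed.

Lemma laid_shift_point j s y m : laid j s y -> laid (j - m) s (shiftz m y).
Proof. by move=> L n l; rewrite /shiftz -L; congr y; lia. Qed.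

Lemma written_shift_offset j y m : written j y -> written (j + q%:Z * m) y.
Proof.
move=> [s ns L]; exists (shiftz m s); first exact: no_even_square_shiftz.
exact: laid_shift_offset.
Qed.

Lemma written_shift_point j y m : written j y -> written (j - m) (shiftz m y).
Proof. by move=> [s ns L]; exists s => //; apply: laid_shift_point. Qed.

Hypothesis q0 : (0 < q)%N.

Lemma split_position j i : exists n (l : 'I_q), i = j + q%:Z * n + l%:Z.
Proof.
have lt_q : (`|((i - j) %% q%:Z)%Z| < q)%N by lia.
exists ((i - j) %/ q%:Z)%Z, (Ordinal lt_q) => /=.
have := divz_eq (i - j) q%:Z; rewrite mulrC; lia.
Qed.

Lemma position_inj j n n' (l l' : 'I_q) :
  j + q%:Z * n + l%:Z = j + q%:Z * n' + l'%:Z -> n = n' /\ l = l'.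
Proof.
have := ltn_ord l; have := ltn_ord l' => l'q lq e.
have nn : n = n' by nia.
by split=> //; apply/val_inj => /=; move: e; rewrite nn; lia.
Qed.

Lemma laid_exists j s : exists y, laid j s y.
Proof.
have /choice[y yP] : forall i, exists a, forall n (l : 'I_q),
    i = j + q%:Z * n + l%:Z -> a = C (s n) l.
  move=> i; have [n [l ->]] := split_position j i.
  by exists (C (s n) l) => n' l' /position_inj[-> ->].
by exists y => n l; apply: yP.
Qed.

Lemma laid_inj j s y y' : laid j s y -> laid j s y' -> y = y'.
Proof.
move=> L L'; apply/funext => i; have [n [l ->]] := split_position j i.
by rewrite L L'.
Qed.

Hypothesis C_neq : exists d, C false d <> C true d.

Lemma laid_letter j s s' y y' n : laid j s y -> laid j s' y' ->
  (forall l : 'I_q, y (j + q%:Z * n + l%:Z) = y' (j + q%:Z * n + l%:Z)) ->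
  s n = s' n.
Proof.
move=> L L' e; have [d dP] := C_neq; have := e d; rewrite L L'.
by case: (s n); case: (s' n) => // /esym.
Qed.

(** Let D be the nonempty set of indices d with C false d <> C true d. If y is
laid out from j and from j + r, compare the two descriptions of y at the index
d in D of the blocks starting from j + r. In the blocks from j this position
has index d + r in the same block, or d + r - q in the next one. In the first
case (up) letters_determined gives d + r in D and s = s', in the second (down)
d + r - q in D and s' = shiftz 1 s. As s is not constant, only one of the two
cases can occur for all d in D, which is absurd in a finite set. *)
Lemma no_intermediate_offset j (r : nat) s s' y : (0 < r < q)%N ->
  no_even_square s -> no_even_square s' ->
  laid j s y -> ~ laid (j + r%:Z) s' y.
Proof.
move=> /andP[r0 rq] ns ns' L L'.
have up (l l' : 'I_q) : l' = (l + r)%N :> nat ->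
    C false l <> C true l -> C false l' <> C true l' /\ s = s'.
  move=> e D.
  apply: (letters_determined (f := C^~ l) (g := C^~ l') ns ns' D) => n.
  by rewrite /= -L -L'; congr y; lia.
have down (l l' : 'I_q) : (l' + q = l + r)%N ->
    C false l <> C true l -> C false l' <> C true l' /\ shiftz 1 s = s'.
  move=> e D.
  apply: (letters_determined (f := C^~ l) (g := C^~ l')
    (no_even_square_shiftz (n := 1) ns) ns' D).
  by move=> n; rewrite /shiftz /= -L -L'; congr y; lia.
have [ss'|ss'] := pselect (s = s').
(* Only [up] can apply: the indices in D increase without bound. *)
- have [d D] := C_neq.
  have [m] := ubnP (q - d)%N; elim: m d D => // m IHm d D dm.
  have [drq|qdr] := ltnP (d + r)%N q.
    have [D' _] := up d (Ordinal drq) erefl D.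
    by apply: (IHm _ D') => /=; lia.
  have lt_q : (d + r - q < q)%N by have := ltn_ord d; lia.
  have [|_ e] := down d (Ordinal lt_q) _ D; first by rewrite /=; lia.
  have [n [s0 s1]] := @pair_occurs s false true ns isT.
  by have := congr1 (@^~ n) e; rewrite -ss' /shiftz s0 s1.
(* Only [down] can apply: the indices in D decrease without bound. *)
- have [d D] := C_neq.
  have [m] := ubnP d; elim: m d D => // m IHm d D dm.
  have [drq|qdr] := ltnP (d + r)%N q.
    by have [_] := up d (Ordinal drq) erefl D.
  have lt_q : (d + r - q < q)%N by have := ltn_ord d; lia.
  have [|D' _] := down d (Ordinal lt_q) _ D; first by rewrite /=; lia.
  by apply: (IHm _ D') => /=; lia.
Qed.

Lemma laid_unique j j' s s' y : no_even_square s -> no_even_square s' ->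
  laid j s y -> laid j' s' y -> exists m, j' = j + q%:Z * m /\ s' = shiftz m s.
Proof.
move=> ns ns' L L'; have [m [r e]] := split_position j j'.
have {L} Lm := laid_shift_offset m L.
have nsm := no_even_square_shiftz (n := m) ns.
exists m; have [r0|r0] := posnP r; last first.
  have := @no_intermediate_offset (j + q%:Z * m) r _ _ y _ nsm ns' Lm.
  by rewrite r0 ltn_ord -e => /(_ isT).
rewrite r0 addr0 in e; rewrite e in L' *; split=> //.
by apply/funext => n; apply: laid_letter L' Lm _.
Qed.

Lemma position_bound j n (l : 'I_q) N : (`|n| <= N)%N ->
  (`|(j + q%:Z * n + l%:Z)%R| <= `|j| + q * N + q)%N.
Proof.
move=> nN; have := leq_mul (leqnn q) nN; have := ltn_ord l.
by have := abszM q%:Z n; lia.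
Qed.

Lemma written_closed j y :
  (forall N, exists2 y', written j y' & agree N y y') -> written j y.
Proof.
move=> H.
have /choice[s L] : forall n, exists b, forall l : 'I_q,
    y (j + q%:Z * n + l%:Z) = C b l.
  move=> n; have [y' [s' _ L'] yy'] := H (`|j| + q * `|n| + q)%N.
  by exists (s' n) => l; rewrite yy' //; apply: position_bound.
exists s => //; apply: no_even_square_closed => N.
have [y' [s' ns' L'] yy'] := H (`|j| + q * N + q)%N.
exists s' => // n nN; apply: laid_letter L L' _ => l.
by apply: yy'; apply: position_bound.
Qed.

(** For each of the q offsets r that fail for y, some cylinder around y avoids the
closed set of points written with offset r; intersect these cylinders. *)
Lemma written_offset_locally_constant y :
  exists N, forall j y', written j y' -> agree N y y' -> written j y.
Proof.
have /choice[N NP] : forall r : 'I_q, exists N, forall y',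
    written r%:Z y' -> agree N y y' -> written r%:Z y.
  move=> r; have [W|nW] := pselect (written r%:Z y); first by exists 0%N.
  apply: contrapT => /forallNP H; apply: nW; apply: written_closed => N.
  have := H N; apply: contra_notP => /forall2NP H' y' W' yy'.
  by case: (H' y') => [/(_ W')|/(_ yy')].
exists (\max_r N r) => j y' W' yy'.
have [n [r jE]] := split_position 0 j.
have Er : r%:Z = j + q%:Z * - n by rewrite jE; lia.
have {}W' : written r%:Z y' by rewrite Er; apply: written_shift_offset.
have := NP r y' W'; move/(_ (agreeW (leq_bigmax r) yy'))/written_shift_offset.
by move=> /(_ n); rewrite jE add0r addrC.
Qed.

Lemma somewhere_written_closed y :
  (forall N, exists2 y', exists j, written j y' & agree N y y') ->
  exists j, written j y.
Proof.
move=> H; have [N NP] := written_offset_locally_constant y.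
by have [y' [j W'] yy'] := H N; exists j; apply: NP W' yy'.
Qed.

(** A window of y' lies in finitely many blocks, and the word that s' spells there
occurs in s. *)
Lemma written_orbit_closure j j' y y' :
  written j y -> written j' y' -> orbit_closure y y'.
Proof.
move=> [s ns L] [s' ns' L']; apply/closure_fullshiftP => N.
pose M := (N + `|j'|)%N.
have [b bP] := same_language ns ns' (M + M).+1 (- M%:Z).
pose m := j + q%:Z * (b + M%:Z) - j'.
exists (shiftz m y); first by exists m.
move=> i iN; have [n [l iE]] := split_position j' i.
have nM : (`|n| <= M)%N.
  have := ltn_ord l; rewrite /M; move: iN; rewrite iE => iN lq.
  have : (`|(q%:Z * n)%R| < N + `|j'| + q)%N by lia.
  rewrite abszM absz_nat; nia.
rewrite iE L' /shiftz.
have -> : j' + q%:Z * n + l%:Z + m = j + q%:Z * (b + (n + M%:Z)) + l%:Z.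
  by rewrite /m; lia.
rewrite L; congr C.
have := bP `|(n + M%:Z)%R|%N.
have -> : `|(n + M%:Z)%R|%N%:Z = n + M%:Z by lia.
by rewrite addrCA addNr addr0; apply; lia.
Qed.

End Layout.

(** * Replacing blocks is a conjugacy *)

Section Recoding.
Variable q : nat.
Hypothesis q0 : (0 < q)%N.

(** The graph of the map that replaces the blocks of C by those of P. As a
relation it is visibly symmetric in C and P. *)
Definition recoded (A B : choiceType) (C : bool -> 'I_q -> A)
    (P : bool -> 'I_q -> B) (y : fullshift A) (z : fullshift B) : Prop :=
  exists j s, [/\ no_even_square s, laid C j s y & laid P j s z].

Lemma recoded_sym (A B : choiceType) (C : bool -> 'I_q -> A)
    (P : bool -> 'I_q -> B) y z : recoded C P y z -> recoded P C z y.
Proof. by move=> [j [s [ns L L']]]; exists j, s. Qed.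

Section Map.
Variables (A B : choiceType) (C : bool -> 'I_q -> A) (P : bool -> 'I_q -> B).
Hypothesis C_neq : exists d, C false d <> C true d.

Lemma recoded_total : exists h : fullshift A -> fullshift B,
  forall y, (exists j, written C j y) -> recoded C P y (h y).
Proof.
have /choice[h hP] : forall y, exists z,
    (exists j, written C j y) -> recoded C P y z.
  move=> y; have [[j [s ns L]]|nW] := pselect (exists j, written C j y).
  - by have [z L'] := laid_exists P q0 j s; exists z => _; exists j, s.
  - by exists (fun=> P false (Ordinal q0)) => /nW.
by exists h.
Qed.

Lemma recoded_inj y z z' : recoded C P y z -> recoded C P y z' -> z = z'.
Proof.
move=> [j [s [ns L M]]] [j' [s' [ns' L' M']]].
have [m [ej es]] := laid_unique q0 C_neq ns ns' L L'.
apply: (laid_inj q0 _ M'); rewrite ej es; exact: laid_shift_offset.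
Qed.

Lemma recoded_shift y z : recoded C P y z -> recoded C P (shift y) (shift z).
Proof.
move=> [j [s [ns L L']]]; exists (j - 1), s.
by split=> //; [have := laid_shift_point 1 L|have := laid_shift_point 1 L'].
Qed.

(** Near y the offset of y' is that of y, and then the letter of z' at i is decided
by the block of y' at i. *)
Lemma recoded_continuous y z i : recoded C P y z ->
  exists N, forall y' z', recoded C P y' z' -> agree N y y' -> z i = z' i.
Proof.
move=> R; have [N NP] := written_offset_locally_constant q0 C_neq y.
exists (maxn N (`|i| + q)%N) => y' z' [j [s' [ns' L' M']]] yy'.
have [|s ns L] := NP j y' _ (agreeW (leq_maxl _ _) yy'); first by exists s'.
have [z1 M] := laid_exists P q0 j s.
have -> : z = z1 by apply: recoded_inj R _; exists j, s.
have [n [l iE]] := split_position q0 j i.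
rewrite iE M M'; congr P; apply: (laid_letter C_neq L L') => l'.
apply: (agreeW (leq_maxr _ _) yy'); have := ltn_ord l; have := ltn_ord l'; lia.
Qed.

End Map.

Lemma recoding_conjugate (A B : choiceType)
    (C : bool -> 'I_q -> A) (P : bool -> 'I_q -> B) :
  (exists d, C false d <> C true d) -> (exists d, P false d <> P true d) ->
  conjugate [set y | exists j, written C j y] (@shift A)
            [set z | exists j, written P j z] (@shift B).
Proof.
move=> CD PD.
have [h hP] := recoded_total C P; have [g gP] := recoded_total P C.
have rec1 y z : recoded C P y z -> exists j, written C j y.
  by move=> [j [s [ns L _]]]; exists j, s.
have rec2 y z : recoded C P y z -> exists j, written P j z.
  by move=> [j [s [ns _ L]]]; exists j, s.
have hg y : (exists j, written C j y) -> g (h y) = y.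
  move=> W; have R := hP y W; have R' := gP _ (rec2 _ _ R).
  exact: (recoded_inj PD R' (recoded_sym R)).
have gh z : (exists j, written P j z) -> h (g z) = z.
  move=> W; have R := gP z W; have R' := hP _ (rec1 _ _ (recoded_sym R)).
  exact: (recoded_inj CD R' (recoded_sym R)).
exists h; split.
- split=> [y /= W|y y' /set_mem W /set_mem W' e|z /= W].
  + exact: rec2 (hP y W).
  + by rewrite -(hg y W) e hg.
  + exists (g z); last exact: gh.
    by have := gP z W => /recoded_sym/rec1.
- apply/within_continuousP => y i W.
  have [N NP] := recoded_continuous CD i (hP y W).
  by exists N => y' W'; apply: NP (hP y' W').
- exists g; last by move=> y /set_mem /hg.
  apply/within_continuousP => z i W.
  have [N NP] := recoded_continuous PD i (gP z W).
  by exists N => z' W'; apply: NP (gP z' W').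
- move=> y W; have R := recoded_shift (hP y W).
  exact: (recoded_inj CD (hP _ (rec1 _ _ R)) R).
Qed.

End Recoding.

(** * The blocks of the iterated substitution *)

(** The word tau^k(b): the recursion is tau^(k+1)(b) = tau^k(tau(b)), where tau(b)
is 0 followed by the other letter. *)
Fixpoint tau_iter (k : nat) (b : bool) : seq bool :=
  if k is k'.+1 then tau_iter k' false ++ tau_iter k' (~~ b) else [:: b].

Definition tau_block k (b : bool) (l : 'I_(2 ^ k)) : bool :=
  nth false (tau_iter k b) l.

Lemma size_tau_iter k b : size (tau_iter k b) = (2 ^ k)%N.
Proof.
by elim: k b => //= k IH b; rewrite size_cat !IH addnn -mul2n -expnS.
Qed.

Lemma nth_tau_iter_lt k b b' l : (l.+1 < 2 ^ k)%N ->
  nth false (tau_iter k b) l = nth false (tau_iter k b') l.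
Proof.
elim: k b b' l => [|k IH] b b' l //=.
rewrite expnS mul2n -addnn => lk; rewrite !nth_cat size_tau_iter.
by case: ltnP => // kl; apply: IH; lia.
Qed.

Lemma nth_tau_iter_last k b :
  nth false (tau_iter k b) (2 ^ k).-1 = b (+) odd k.
Proof.
elim: k b => [|k IH] b /=; first by rewrite addbF.
have k0 : (0 < 2 ^ k)%N by rewrite expn_gt0.
rewrite expnS mul2n -addnn nth_cat size_tau_iter ltnNge.
have -> : (2 ^ k <= (2 ^ k + 2 ^ k).-1)%N by lia.
have -> : ((2 ^ k + 2 ^ k).-1 - 2 ^ k = (2 ^ k).-1)%N by lia.
by rewrite /= IH addNb addbN.
Qed.

Lemma tau_block_neq k : exists d, @tau_block k false d <> @tau_block k true d.
Proof.
have k0 : ((2 ^ k).-1 < 2 ^ k)%N by rewrite prednK // expn_gt0.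
by exists (Ordinal k0); rewrite /tau_block /= !nth_tau_iter_last; case: odd.
Qed.

(** Two consecutive blocks tau^k form one block tau^(k+1). *)
Lemma laid_tauS k j u s :
  laid (@tau_block k) j (taubar u) s <-> laid (@tau_block k.+1) j u s.
Proof.
have E : (2 ^ k.+1)%N%:Z = 2 * (2 ^ k)%N%:Z by rewrite expnS PoszM.
have En : (2 ^ k.+1)%N = (2 ^ k + 2 ^ k)%N by rewrite expnS mul2n addnn.
split=> L n l; rewrite /tau_block /=.
- have lq : (l < 2 ^ k + 2 ^ k)%N by rewrite -En.
  rewrite nth_cat size_tau_iter E.
  case: ltnP => lk.
  + have := L (2 * n) (Ordinal lk); rewrite taubar_even /tau_block /= => <-.
    by congr s; lia.
  + have lt_q : (l - 2 ^ k < 2 ^ k)%N by lia.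
    have := L (2 * n + 1) (Ordinal lt_q).
    rewrite taubar_odd /tau_block /= => <-.
    by congr s; lia.
- have := ltn_ord l => lq.
  have [m [e|e]] : exists m, n = 2 * m \/ n = 2 * m + 1.
    by exists (n %/ 2)%Z; lia.
  + have lt_q : (l < 2 ^ k.+1)%N by rewrite En; lia.
    have := L m (Ordinal lt_q); rewrite E.
    rewrite e taubar_even /tau_block /= nth_cat size_tau_iter lq => <-.
    by congr s; lia.
  + have lt_q : (2 ^ k + l < 2 ^ k.+1)%N by rewrite En; lia.
    have := L m (Ordinal lt_q); rewrite E.
    rewrite e taubar_odd /tau_block /= nth_cat size_tau_iter.
    rewrite ltnNge leq_addr /= addKn => <-.
    by congr s; lia.
Qed.

(** Left to right by desubstituting k times, right to left by applying taubar k
times. *)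
Lemma tau_written k s :
  no_even_square s <-> exists j, written (@tau_block k) j s.
Proof.
split.
- elim: k s => [|k IH] s ns.
    exists 0, s => // n l; rewrite /tau_block /=.
    have -> : nat_of_ord l = 0%N by have := ltn_ord l; lia.
    by congr s => /=; lia.
  have [j [u nu L]] := IH s ns.
  have [e [v [nv ev]]] := desubstitution nu.
  exists (j + (2 ^ k)%N%:Z * - e), v => //; apply/laid_tauS.
  have -> : taubar v = shiftz (- e) u.
    by apply/funext => i; rewrite ev /shiftz subrK.
  exact: laid_shift_offset.
- move=> [j [u nu L]]; elim: k u nu L => [|k IH] u nu L.
    have -> : s = shiftz (- j) u; last exact: no_even_square_shiftz.
    apply/funext => i; have := L (i - j) ord0.
    rewrite /tau_block /shiftz /= => <-.
    by congr s; lia.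
  by move/laid_tauS: L; apply: IH; apply/no_even_square_taubar.
Qed.

(** * Images of the Toeplitz minimal set *)

Definition block_code (A : Type) q (C0 C1 : q.-tuple A) (b : bool) (l : 'I_q) :=
  tnth (if b then C1 else C0) l.

Lemma so_writtenE (A : choiceType) k (C0 C1 : (2 ^ k).-tuple A) y :
  so_written C0 C1 y <-> exists j, written (block_code C0 C1) j y.
Proof.
have E j s : concatenation C0 C1 j s y <-> laid (block_code C0 C1) j s y.
  split=> [H n l|H n].
  - have := congr1 (fun w => nth (y 0) w l) (H n).
    by rewrite nth_mkseq // => ->; rewrite /block_code (tnth_nth (y 0)).
  - apply: (@eq_from_nth _ (y 0)); rewrite size_mkseq ?size_tuple // => i iq.
    rewrite nth_mkseq //; have := H n (Ordinal iq).
    by rewrite /block_code (tnth_nth (y 0)).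
split=> [[j [s [/E L ns]]]|[j [s ns L]]]; exists j, s => //.
by split=> //; apply/E.
Qed.

Lemma block_code_neq (A : Type) q (C0 C1 : q.-tuple A) : C0 <> C1 ->
  exists d, block_code C0 C1 false d <> block_code C0 C1 true d.
Proof.
move=> C01; apply: contrapT => /forallNP H; apply: C01.
by apply: eq_from_tnth => d; have := H d; rewrite notK.
Qed.

Lemma equivariant_shiftz (A B : choiceType) (X : set (fullshift A))
    (g : fullshift A -> fullshift B) :
  (forall n x, X x -> X (shiftz n x)) ->
  (forall x, X x -> g (shift x) = shift (g x)) ->
  forall n x, X x -> g (shiftz n x) = shiftz n (g x).
Proof.
move=> XS gS.
have pos (n : nat) x : X x -> g (shiftz n%:Z x) = shiftz n%:Z (g x).
  move=> Xx; elim: n => [|n IH]; first by rewrite !shiftz0.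
  by rewrite -addn1 PoszD !shiftzS gS ?IH //; apply: XS.
case=> n x Xx; first exact: pos.
have := pos n.+1 (shiftz (Negz n) x) (XS _ _ Xx).
have -> : shiftz n.+1%:Z (shiftz (Negz n) x) = x.
  by apply/funext => i; rewrite /shiftz; congr x; lia.
by move=> ->; apply/funext => i; rewrite /shiftz; congr (g _ _); lia.
Qed.

(** The block boundaries of the image are placed r positions before the last
letters of the blocks tau^k of x, the only letters of x that are not forced by
periodicity. *)
Lemma image_written (A : choiceType) (g : fullshift bool -> fullshift A) :
  {within no_even_square, continuous g} ->
  (forall x, no_even_square x -> g (shift x) = shift (g x)) ->
  set_inj no_even_square g ->
  exists k (C0 C1 : (2 ^ k).-tuple A), C0 <> C1 /\
  exists2 x, no_even_square x & so_written C0 C1 (g x).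
Proof.
move=> gc gS gI.
have gZ := equivariant_shiftz (fun n x => @no_even_square_shiftz x n) gS.
have Tcl : closed no_even_square.
  by rewrite -toeplitz_minimal_setE; exact: closed_closure.
have [r rP] := uniform_local_rule 0 Tcl gc.
pose x := toeplitz_point false.
have nx : no_even_square x.
  by apply: no_even_square_taubar2_fixed; have [] := toeplitz_pointP false.
pose k := (r + r).+1; pose q := (2 ^ k)%N.
have rq : (r + r + 1 < q)%N by rewrite addn1; apply: ltn_expl.
have [J [s ns L]] := proj1 (tau_written k x) nx.
pose j := J + q%:Z - 1 - r%:Z.
(* A coordinate of g x sees a window of x of length 2r + 1 < q, which contains
   at most one last letter of a block, the one of block n. *)
have local n n' (l : nat) : (l < q)%N -> s n = s n' ->
    g x (j + q%:Z * n + l%:Z) = g x (j + q%:Z * n' + l%:Z).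
  move=> lq snn'.
  have g0 i : g x i = g (shiftz i x) 0 by rewrite gZ // /shiftz add0r.
  rewrite !g0; apply: rP; try exact: no_even_square_shiftz.
  move=> a ar; rewrite /shiftz.
  have lastq : (q.-1 < q)%N by lia.
  have xP m i (iq : (i < q)%N) :
      x (J + q%:Z * m + i%:Z) = nth false (tau_iter k (s m)) i.
    exact: (L m (Ordinal iq)).
  (* The coordinate of x under consideration is the last letter of block n, or
     lies before it in block n, or after it in block n + 1. *)
  have [e|[e|e]] : l%:Z + a - r%:Z = 0 \/ l%:Z + a - r%:Z < 0 \/
      0 < l%:Z + a - r%:Z by lia.
  - have -> : a + (j + q%:Z * n + l%:Z) = J + q%:Z * n + q.-1%:Z by lia.
    have -> : a + (j + q%:Z * n' + l%:Z) = J + q%:Z * n' + q.-1%:Z by lia.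
    by rewrite !xP ?snn'.
  - pose i := `|(q%:Z - 1 + (l%:Z + a - r%:Z))%R|%N.
    have -> : a + (j + q%:Z * n + l%:Z) = J + q%:Z * n + i%:Z by lia.
    have -> : a + (j + q%:Z * n' + l%:Z) = J + q%:Z * n' + i%:Z by lia.
    by rewrite !xP; [apply: nth_tau_iter_lt|..]; rewrite -/q; lia.
  - pose i := `|(l%:Z + a - r%:Z - 1)%R|%N.
    have -> : a + (j + q%:Z * n + l%:Z) = J + q%:Z * (n + 1) + i%:Z by lia.
    have -> : a + (j + q%:Z * n' + l%:Z) = J + q%:Z * (n' + 1) + i%:Z by lia.
    by rewrite !xP; [apply: nth_tau_iter_lt|..]; rewrite -/q; lia.
have [p [p0 p1]] := @pair_occurs s false true ns isT.
pose C m : (2 ^ k).-tuple A := [tuple g x (j + q%:Z * m + l%:Z) | l < 2 ^ k].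
have gxE n (l : 'I_(2 ^ k)) :
    g x (j + q%:Z * n + l%:Z) = block_code (C p) (C (p + 1)) (s n) l.
  rewrite /block_code; case e : (s n); rewrite tnth_mktuple;
  by apply: local; rewrite ?e ?p0 ?p1.
exists k, (C p), (C (p + 1)); split; last first.
  by exists x => //; apply/so_writtenE; exists j, s.
(* Equal blocks would make g x periodic, hence x, hence s constant. *)
move=> eC.
have q0 : (0 < 2 ^ k)%N by lia.
have per : shiftz q%:Z (g x) = g x.
  apply/funext => i; have [n [l ->]] := split_position q0 j i.
  rewrite /shiftz gxE.
  have -> : j + (2 ^ k)%N%:Z * n + l%:Z + q%:Z = j + q%:Z * (n + 1) + l%:Z.
    by rewrite /q; lia.
  by rewrite gxE /block_code eC !if_same.
have {}per : shiftz q%:Z x = x.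
  apply: gI; rewrite ?inE ?gZ //; exact: no_even_square_shiftz.
have lastq : (q.-1 < 2 ^ k)%N by lia.
have := L p (Ordinal lastq); have := L (p + 1) (Ordinal lastq).
rewrite -{2}per /shiftz.
have -> : J + (2 ^ k)%N%:Z * p + Ordinal lastq + q%:Z =
    J + (2 ^ k)%N%:Z * (p + 1) + Ordinal lastq by rewrite /q; lia.
rewrite /tau_block [nat_of_ord _]/((2 ^ k).-1) !nth_tau_iter_last p0 p1.
by move=> ->; case: odd.
Qed.

(** * The characterization *)

Lemma shift_invariant_shiftz (A : choiceType) (Y : set (fullshift A)) :
  shift (A := A) @` Y = Y -> forall n y, Y y -> Y (shiftz n y).
Proof.
move=> YS.
have pos (m : nat) y : Y y -> Y (shiftz m%:Z y).
  move=> Yy; elim: m => [|m IH]; first by rewrite shiftz0.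
  by rewrite -addn1 PoszD shiftzS -YS; exists (shiftz m%:Z y).
have neg (m : nat) y : Y y -> Y (shiftz (- m%:Z) y).
  move=> Yy; elim: m => [|m]; first by rewrite shiftz0.
  rewrite -{1}YS => -[w Yw wE].
  suff -> : shiftz (- m.+1%:Z) y = w by [].
  apply/funext => i; have := congr1 (@^~ (i - 1)) wE.
  by rewrite /shift /shiftz subrK => ->; congr y; lia.
by case=> m y Yy; [exact: pos|rewrite NegzE; exact: neg].
Qed.

Theorem mainTheorem2 (A : finType) (Y : set (fullshift A))
    (hY : symbolic_minimal_set Y) :
  (conjugate Y (@shift A) toeplitz_minimal_set (@shift bool) <->
   exists (k : nat) (C0 C1 : (2 ^ k).-tuple A),
     C0 <> C1 /\ exists2 y, Y y & so_written C0 C1 y)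
  /\
  (forall (k : nat) (C0 C1 : (2 ^ k).-tuple A), C0 <> C1 ->
     (exists2 y, Y y & so_written C0 C1 y) ->
     forall y, Y y -> so_written C0 C1 y).
Proof.
have [_ Ycl YS Ymin] := hY.
have all_written k (C0 C1 : (2 ^ k).-tuple A) : C0 <> C1 ->
     (exists2 y, Y y & so_written C0 C1 y) ->
     forall y, Y y -> so_written C0 C1 y.
  move=> C01 [y0 Yy0 /so_writtenE[j W]] y Yy; apply/so_writtenE.
  have q0 : (0 < 2 ^ k)%N by rewrite expn_gt0.
  apply: (somewhere_written_closed q0 (block_code_neq C01)) => N.
  have /closure_fullshiftP/(_ N)[_ [n _ <-] yn] := Ymin _ Yy0 _ Yy.
  exists (shiftz n y0) => //; exists (j - n); exact: written_shift_point.
split=> //; rewrite toeplitz_minimal_setE; split.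
- move=> [h [hb _ [g gc gh] hS]].
  have [hY' hI hsurj] := hb.
  have gT x : no_even_square x -> Y (g x) /\ h (g x) = x.
    by move=> /hsurj[y Yy <-]; rewrite gh // inE.
  have [|x x' /set_mem nx /set_mem nx' e|k [C0 [C1 [C01 [x nx W]]]]] :=
    image_written gc.
  + move=> x nx; have [Yg hg] := gT x nx.
    rewrite -{1}hg -hS // gh // inE -YS; by exists (g x).
  + by have [_ <-] := gT x nx; have [_ <-] := gT x' nx'; rewrite e.
  + by exists k, C0, C1; split=> //; exists (g x) => //; have [] := gT x nx.
- move=> [k [C0 [C1 [C01 Wy]]]].
  have [y0 Yy0 /so_writtenE[j0 W0]] := Wy.
  have q0 : (0 < 2 ^ k)%N by rewrite expn_gt0.
  have -> : Y = [set y | exists j, written (block_code C0 C1) j y].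
    apply/seteqP; split=> y.
      by move=> Yy; apply/so_writtenE; apply: all_written.
    move=> [j W]; rewrite (closure_id Y).1 //.
    apply: (closureS _ (written_orbit_closure q0 W0 W)) => _ [n _ <-].
    exact: shift_invariant_shiftz.
  have -> : no_even_square = [set s | exists j, written (@tau_block k) j s].
    by apply/funext => s; apply/propext; exact: tau_written.
  apply: recoding_conjugate => //; first exact: block_code_neq.
  exact: tau_block_neq.
Qed.
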